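(* Let $A\in\mathbb{R}^{m\times n}$, $b\in\mathbb{R}^m$, $x_0\in\mathbb{R}^n$, and let $M_1,M_2,\ldots\in\mathbb{R}^{n\times n}$ be symmetric positive definite matrices. Apply both the Fast Flexible Golub-Kahan recurrence (underlying FaFLSQR) and the Flexible CGLS algorithm (FCGLS), both defined in the context, to the same input $A,b,x_0,M_1,M_2,\ldots$, and let $K\ge1$ be such that neither algorithm stops before producing $z_1,\ldots,z_K$ and $\hat s_0,\ldots,\hat s_{K-1}$, respectively. Then the vectors $z_k$ are scalar multiples of the vectors $\hat s_{k-1}$, i.e. for every $k=1,\ldots,K$, $$z_k=\eta_k\,\hat s_{k-1}\quad\text{for some }\eta_k\in\mathbb{R},\ \eta_k\ne0.$$
   Context: All computations are in exact arithmetic. $(x,y)=x^Ty$ is the Euclidean inner product and $\|\cdot\|$ the Euclidean norm. Fast Flexible Golub-Kahan recurrence. Set $r_0=b-Ax_0$, $\beta_1=\|r_0\|$, $u_1=r_0/\beta_1$, $v_0=0$. For $k=1,2,\ldots$: (1) $\hat v:=A^Tu_k-\beta_kv_{k-1}$, $\hat z:=M_k^{-1}\hat v$, $\alpha_k:=(\hat z,\hat v)^{1/2}$; (2) $v_k:=\hat v/\alpha_k$, $z_k:=\hat z/\alpha_k$ (so $z_k=M_k^{-1}v_k$); (3) $n_{j,k}:=(Az_k)^Tu_j$ for $j=1,\ldots,k$, and $\hat u:=Az_k-\sum_{j=1}^k n_{j,k}u_j$; (4) $\beta_{k+1}:=\|\hat u\|$, $u_{k+1}:=\hat u/\beta_{k+1}$.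 Flexible CGLS (FCGLS). Set $\hat x_0=x_0$, $r_0=b-Ax_0$, $s_0=A^Tr_0$, $\hat s_0=M_1^{-1}s_0$, $p_0=\hat s_0$, $q_0=Ap_0$. For $k=1,2,\ldots$: (1) $\gamma_{k-1}=(r_{k-1},q_{k-1})/\|q_{k-1}\|^2$; (2) $\hat x_k=\hat x_{k-1}+\gamma_{k-1}p_{k-1}$, $r_k=r_{k-1}-\gamma_{k-1}q_{k-1}$; (3) $s_k=A^Tr_k$, $\hat s_k=M_{k+1}^{-1}s_k$; (4) $\theta_j^{k-1}=-(A\hat s_k,q_j)/\|q_j\|^2$ for $j=0,\ldots,k-1$; (5) $p_k=\hat s_k+\sum_{j=0}^{k-1}\theta_j^{k-1}p_j$, $q_k=A\hat s_k+\sum_{j=0}^{k-1}\theta_j^{k-1}q_j$. That the algorithms do not stop before producing the stated vectors means that $\beta_1,\ldots,\beta_K$ and $\alpha_1,\ldots,\alpha_K$ are all nonzero in the first algorithm and that $q_0,\ldots,q_{K-2}$ are all nonzero in FCGLS (no condition on the $q_j$ if $K=1$). *)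

(* Defs.v *)
From mathcomp Require Import all_boot all_order all_algebra.
From mathcomp Require Import reals.
Set Implicit Arguments.
Unset Strict Implicit.
Unset Printing Implicit Defensive.
Import Order.TTheory GRing.Theory Num.Theory.
Local Open Scope ring_scope.

Section EuclideanSpace.
Context {R : realType}.

Definition dot {d : nat} (x y : 'cV[R]_d) : R := (x^T *m y) 0 0.

(* The library norm on matrices is the sup norm, hence this definition. *)
Definition enorm {d : nat} (x : 'cV[R]_d) : R := Num.sqrt (dot x x).

Definition spd {d : nat} (M : 'M[R]_d) : Prop :=
  M^T = M /\ forall x : 'cV[R]_d, x != 0 -> 0 < dot x (M *m x).

End EuclideanSpace.

(* Both recurrences are total functions of the iteration number, with the
   convention 0^-1 = 0 after a breakdown.  Preconditioners are numbered from 1: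
   [M 0] is never used. *)
Section Algorithms.
Context {R : realType} {m n : nat}.
Variables (A : 'M[R]_(m, n)) (b : 'cV[R]_m) (x0 : 'cV[R]_n).
Variable (M : nat -> 'M[R]_n).

(* Fast Flexible Golub-Kahan: the data with which iteration k starts, that is
   u_1, ..., u_k (in this order), beta_k and v_(k-1). *)
Record gk_state := GKState {
  gk_us : seq 'cV[R]_m;
  gk_beta : R;
  gk_vprev : 'cV[R]_n
}.

Definition gk_init : gk_state :=
  let r0 := b - A *m x0 in
  let beta1 := enorm r0 in
  GKState [:: beta1^-1 *: r0] beta1 0.

Section Iteration.
Variables (k : nat) (st : gk_state).

Definition gk_vhat : 'cV[R]_n :=
  A^T *m last 0 (gk_us st) - gk_beta st *: gk_vprev st.
Definition gk_zhat : 'cV[R]_n := invmx (M k) *m gk_vhat.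
Definition gk_alpha : R := Num.sqrt (dot gk_zhat gk_vhat).
Definition gk_v : 'cV[R]_n := gk_alpha^-1 *: gk_vhat.
Definition gk_z : 'cV[R]_n := gk_alpha^-1 *: gk_zhat.
Definition gk_uhat : 'cV[R]_m :=
  A *m gk_z - \sum_(uj <- gk_us st) dot (A *m gk_z) uj *: uj.

Definition gk_next : gk_state :=
  let beta := enorm gk_uhat in
  GKState (rcons (gk_us st) (beta^-1 *: gk_uhat)) beta gk_v.

End Iteration.

(* State reached when iterations 1, ..., k have been performed. *)
Fixpoint gk_run (k : nat) : gk_state :=
  if k is k'.+1 then gk_next k (gk_run k') else gk_init.

(* beta_k, alpha_k and z_k, for k >= 1. *)
Definition ffgk_beta (k : nat) : R := gk_beta (gk_run k.-1).
Definition ffgk_alpha (k : nat) : R := gk_alpha k (gk_run k.-1).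
Definition ffgk_z (k : nat) : 'cV[R]_n := gk_z k (gk_run k.-1).

(* FCGLS: the iterates of index k, and (p_0, q_0), ..., (p_k, q_k) in this
   order. *)
Record cg_state := CGState {
  cg_x : 'cV[R]_n;
  cg_r : 'cV[R]_m;
  cg_shat : 'cV[R]_n;
  cg_pqs : seq ('cV[R]_n * 'cV[R]_m)
}.

Definition cg_init : cg_state :=
  let r0 := b - A *m x0 in
  let s0 := A^T *m r0 in
  let shat0 := invmx (M 1) *m s0 in
  let p0 := shat0 in
  CGState x0 r0 shat0 [:: (p0, A *m p0)].

Definition cg_next (k : nat) (st : cg_state) : cg_state :=
  let: (p', q') := last (0, 0) (cg_pqs st) in
  let gamma := dot (cg_r st) q' / enorm q' ^+ 2 in
  let x := cg_x st + gamma *: p' in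
  let r := cg_r st - gamma *: q' in
  let s := A^T *m r in
  let shat := invmx (M k.+1) *m s in
  let theta (qj : 'cV[R]_m) := - dot (A *m shat) qj / enorm qj ^+ 2 in
  let p := shat + \sum_(pq <- cg_pqs st) theta pq.2 *: pq.1 in
  let q := A *m shat + \sum_(pq <- cg_pqs st) theta pq.2 *: pq.2 in
  CGState x r shat (rcons (cg_pqs st) (p, q)).

(* State reached when iterations 1, ..., k have been performed. *)
Fixpoint cg_run (k : nat) : cg_state :=
  if k is k'.+1 then cg_next k (cg_run k') else cg_init.

(* \hat s_k and q_k, for k >= 0. *)
Definition fcgls_shat (k : nat) : 'cV[R]_n := cg_shat (cg_run k).
Definition fcgls_q (k : nat) : 'cV[R]_m := (last (0, 0) (cg_pqs (cg_run k))).2.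

End Algorithms.

(* Main.v *)
(** Write [u_k], [v_k], [z_k] for the Golub-Kahan vectors (numbered from 0
    here). Orthonormality of the [u_k] gives [(z_j, v_k) = 0] for [j < k].
    Choose [d_0 = 1] and [d_(k+1)] such that
    [d_k alpha_k + d_(k+1) beta_(k+1) = 0]; then the combination
    [w_k = d_0 u_0 + ... + d_k u_k] telescopes to [A^T w_k = d_k alpha_k v_k],
    so that [w_k] is orthogonal to [A z_j] for [j < k].  The FCGLS residual
    [r_k] is orthogonal to [q_0, ..., q_(k-1)], which span the same space as
    [A z_0, ..., A z_(k-1)].  As [w_k] lies in the span of [r_k] and of these
    [q_j], it is a multiple of [r_k], and applying [M^-1 A^T] to both vectors
    shows that [z_k] is a multiple of [\hat s_k]. *)
Require Import Defs.
From mathcomp Require Import all_boot all_order all_algebra.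
From mathcomp Require Import reals.
Import Order.TTheory GRing.Theory Num.Theory.
Local Open Scope ring_scope.

(** * The inner product, spans and Gram-Schmidt *)

Section Dot.
Context {R : realType} {d : nat}.

Lemma dotC (x y : 'cV[R]_d) : dot x y = dot y x.
Proof. by rewrite /dot -[in LHS](trmxK y) -trmx_mul mxE. Qed.

Lemma dotDr (x y z : 'cV[R]_d) : dot x (y + z) = dot x y + dot x z.
Proof. by rewrite /dot mulmxDr mxE. Qed.

Lemma dotZr a (x y : 'cV[R]_d) : dot x (a *: y) = a * dot x y.
Proof. by rewrite /dot -scalemxAr mxE. Qed.

Lemma dot0r (x : 'cV[R]_d) : dot x 0 = 0.
Proof. by rewrite -(scale0r x) dotZr mul0r. Qed.

Lemma dotBr (x y z : 'cV[R]_d) : dot x (y - z) = dot x y - dot x z.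
Proof. by rewrite dotDr -scaleN1r dotZr mulN1r. Qed.

Lemma dot_sumr (I : Type) (s : seq I) (x : 'cV[R]_d) (F : I -> 'cV[R]_d) :
  dot x (\sum_(i <- s) F i) = \sum_(i <- s) dot x (F i).
Proof. exact: (big_morph (dot x) (dotDr x) (dot0r x)). Qed.

Lemma dot_mulmx p (B : 'M[R]_(p, d)) x y :
  dot (B *m x) y = dot x (B^T *m y).
Proof. by rewrite /dot trmx_mul mulmxA. Qed.

Lemma dotE (x : 'cV[R]_d) : dot x x = \sum_i x i 0 ^+ 2.
Proof. by rewrite /dot mxE; apply: eq_bigr => i _; rewrite mxE expr2. Qed.

Lemma dot_ge0 (x : 'cV[R]_d) : 0 <= dot x x.
Proof. by rewrite dotE sumr_ge0 // => i _; rewrite sqr_ge0. Qed.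

Lemma dot_eq0 (x : 'cV[R]_d) : (dot x x == 0) = (x == 0).
Proof.
apply/idP/eqP => [|->]; last by rewrite dot0r.
rewrite dotE psumr_eq0 => [/allP h|i _]; last exact: sqr_ge0.
apply/matrixP => i j; rewrite (ord1 j) mxE; apply/eqP.
by rewrite -sqrf_eq0 (implyP (h i (mem_index_enum i))).
Qed.

Lemma enorm_sqr (x : 'cV[R]_d) : enorm x ^+ 2 = dot x x.
Proof. by rewrite sqr_sqrtr ?dot_ge0. Qed.

Lemma dot_span0 (s : seq 'cV[R]_d) y z :
  (forall x, x \in s -> dot y x = 0) -> z \in <<s>>%VS -> dot y z = 0.
Proof.
move=> ys zs; rewrite (coord_span (X := in_tuple s) zs) dot_sumr big1 // => i _.
by rewrite dotZr ys ?mulr0 // mem_nth // size_tuple.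
Qed.

(** The vectors are not assumed normalised, so this serves both the orthonormal [u] of Golub-Kahan
    and the [q] of FCGLS. *)
Lemma dot_gram_schmidt (e : nat -> 'cV[R]_d) k x j :
  (j < k)%N -> e j != 0 ->
  (forall i, (i < k)%N -> i != j -> dot (e j) (e i) = 0) ->
  dot (e j) (x - \sum_(i < k) (dot x (e i) / enorm (e i) ^+ 2) *: e i) = 0.
Proof.
move=> jk ej orth; rewrite dotBr dot_sumr (bigD1 (Ordinal jk)) //=.
rewrite big1 => [|i ij]; last by rewrite dotZr orth ?mulr0.
by rewrite addr0 dotZr enorm_sqr divfK ?dot_eq0 // dotC subrr.
Qed.

End Dot.

(** * The Golub-Kahan recurrence, with indices shifted to start at 0 *)

Section GolubKahan.
Context {R : realType} {m n : nat}.
Variables (A : 'M[R]_(m, n)) (b : 'cV[R]_m) (x0 : 'cV[R]_n).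
Variable (M : nat -> 'M[R]_n).

Local Notation run := (gk_run A b x0 M).
Definition gku k : 'cV[R]_m := last 0 (gk_us (run k)).
Definition gkvhat k : 'cV[R]_n := gk_vhat A (run k).
Local Notation u := gku.
Local Notation vhat := gkvhat.
Local Notation be k := (ffgk_beta A b x0 M k.+1).
Local Notation al k := (ffgk_alpha A b x0 M k.+1).
Local Notation z k := (ffgk_z A b x0 M k.+1).

Lemma gk_usE k : gk_us (run k) = [seq u i | i <- iota 0 k.+1].
Proof.
elim: k => [//|k IH]; rewrite -[k.+2]addn1 iotaD map_cat -IH /= cats1.
by rewrite /gku /= last_rcons.
Qed.

Lemma gku0 : u 0 = (be 0)^-1 *: (b - A *m x0). Proof. by []. Qed.

Lemma gkuS k : u k.+1 = (be k.+1)^-1 *: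
  (A *m z k - \sum_(i < k.+1) dot (A *m z k) (u i) *: u i).
Proof.
rewrite /gku /ffgk_beta /= last_rcons /gk_uhat gk_usE big_map.
by rewrite -[iota 0 k.+1]/(index_iota 0 k.+1) big_mkord.
Qed.

Lemma gk_betaS k : be k.+1 =
  enorm (A *m z k - \sum_(i < k.+1) dot (A *m z k) (u i) *: u i).
Proof.
rewrite /ffgk_beta /= /gk_uhat gk_usE big_map.
by rewrite -[iota 0 k.+1]/(index_iota 0 k.+1) big_mkord.
Qed.

Lemma gkvhat0 : A^T *m u 0 = vhat 0.
Proof. by rewrite /gkvhat /gk_vhat scaler0 subr0. Qed.

Lemma gkvhatS k :
  A^T *m u k.+1 = vhat k.+1 + (be k.+1 / al k) *: vhat k.
Proof. by rewrite {2}/gkvhat /gk_vhat -scalerA subrK. Qed.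

Lemma gk_zE k : z k = (al k)^-1 *: (invmx (M k.+1) *m vhat k).
Proof. by []. Qed.

(** Since [Num.sqrt] vanishes on nonpositive reals, a nonzero [al k] forces its radicand to be
    positive, hence equal to [al k ^+ 2]. *)
Lemma dot_z_vhat k : al k != 0 -> dot (z k) (vhat k) = al k.
Proof.
move=> alk; rewrite gk_zE dotC dotZr dotC.
suff -> : dot (invmx (M k.+1) *m vhat k) (vhat k) = al k ^+ 2.
  by rewrite expr2 mulKf.
rewrite sqr_sqrtr //; case: lerP => // /ltW h; move: alk.
by rewrite /ffgk_alpha /gk_alpha ler0_sqrtr ?eqxx.
Qed.

Context {K : nat}.
Hypothesis be_neq0 : forall k, (k < K)%N -> be k != 0.
Hypothesis al_neq0 : forall k, (k < K)%N -> al k != 0.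

Lemma gk_unit k : (k < K)%N -> dot (u k) (u k) = 1.
Proof.
move=> kK; have := be_neq0 _ kK.
case: k kK => [|k] kK; last rewrite gkuS; rewrite ?gku0.
  rewrite dotZr dotC dotZr -enorm_sqr -[enorm _]/(be 0) => h.
  by rewrite expr2 !mulKf // mulVf.
rewrite dotZr dotC dotZr -enorm_sqr -gk_betaS => h.
by rewrite expr2 mulKf // mulVf.
Qed.

Lemma gk_orth j k : (j < k < K)%N -> dot (u j) (u k) = 0.
Proof.
elim/ltn_ind: k j => -[//|k] IH j /andP[jk kK].
rewrite gkuS dotZr -[RHS](mulr0 (be k.+1)^-1); congr (_ * _).
have unit i : (i <= k)%N -> dot (u i) (u i) = 1.
  by move=> ik; apply: gk_unit; apply: leq_trans kK; rewrite ltnS leqW.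
(* The recurrence has no denominators; the unit norms of the earlier [u i] make it agree with
   Gram-Schmidt. *)
rewrite -[RHS](dot_gram_schmidt u _ (A *m z k) j jk).
- congr (dot _ (_ - _)); apply: eq_bigr => i _.
  by rewrite enorm_sqr unit ?divr1 // -ltnS.
- by rewrite -dot_eq0 unit ?oner_eq0.
move=> i ik; rewrite neq_ltn => /orP[ij|ji].
  by rewrite dotC IH // ij; apply: leq_trans kK; rewrite ltnW.
by rewrite IH // ji; apply: leq_trans kK; rewrite ltnW.
Qed.

Lemma mul_gk_z k : (k.+1 < K)%N -> A *m z k =
  be k.+1 *: u k.+1 + \sum_(i < k.+1) dot (A *m z k) (u i) *: u i.
Proof. by move=> kK; rewrite gkuS scalerKV ?subrK // be_neq0. Qed.

(** [A *m z j] lies in the span of [u 0], ..., [u j.+1], with coefficient [be j.+1] on the last: the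
    Hessenberg shape of the recurrence. *)
Lemma dot_mul_gk_z j k : (j < k < K)%N ->
  dot (A *m z j) (u k) = if k == j.+1 then be k else 0.
Proof.
move=> /andP[jk kK]; rewrite dotC mul_gk_z; last exact: leq_ltn_trans kK.
rewrite dotDr dot_sumr big1 ?addr0 => [|i _]; last first.
  by rewrite dotZr (dotC (u k)) gk_orth ?mulr0 // kK (leq_trans (ltn_ord i)).
rewrite dotZr; case: eqP => [->|/eqP kj].
  by rewrite gk_unit ?mulr1 //; apply: leq_ltn_trans kK.
by rewrite dotC gk_orth ?mulr0 // kK ltn_neqAle eq_sym kj jk.
Qed.

(** Moving [A] across in [dot (A *m z j) (u k.+1)] gives [dot (z j) (vhat k.+1)] plus a multiple of
    [dot (z j) (vhat k)]. For [j = k] that last term and the left side both equal [be k.+1]; for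
    [j < k] both vanish. *)
Lemma dot_gk_z_vhat j k : (j < k < K)%N -> dot (z j) (vhat k) = 0.
Proof.
elim: k => [//|k IH] /andP[jk kK].
have := dot_mul_gk_z j k.+1.
rewrite jk kK => /(_ isT); rewrite dot_mulmx gkvhatS dotDr dotZr.
have alk : al k != 0 by rewrite al_neq0 // ltnW.
rewrite eqSS; case: eqP => [<-|/eqP kj].
  rewrite dot_z_vhat // divfK // => h.
  by apply: (addIr (be k.+1)); rewrite h add0r.
rewrite IH; first by rewrite mulr0 addr0.
by rewrite ltn_neqAle eq_sym kj -ltnS jk ltnW.
Qed.

Fixpoint gkd k : R :=
  if k is k'.+1 then - (al k' / be k'.+1) * gkd k' else 1.

Definition gkw k : 'cV[R]_m := \sum_(i < k.+1) gkd i *: u i.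

Lemma gkwS k : gkw k.+1 = gkw k + gkd k.+1 *: u k.+1.
Proof. by rewrite /gkw big_ord_recr. Qed.

Lemma gkd_neq0 k : (k < K)%N -> gkd k != 0.
Proof.
elim: k => [|k IH] kK /=; first exact: oner_neq0.
have kK' := ltnW kK.
by rewrite mulf_neq0 ?IH // oppr_eq0 mulf_neq0 ?invr_eq0 ?be_neq0 ?al_neq0.
Qed.

Lemma mul_beta_gkdS k : (k.+1 < K)%N ->
  be k.+1 * gkd k.+1 = - (al k * gkd k).
Proof.
move=> kK; rewrite -[gkd k.+1]/(- (al k / be k.+1) * gkd k).
by rewrite mulNr mulrN mulrAC mulrC divfK // be_neq0.
Qed.

Lemma trmx_mul_gkw k : (k < K)%N -> A^T *m gkw k = gkd k *: vhat k.
Proof.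
elim: k => [|k IH] kK.
  by rewrite /gkw big_ord_recl big_ord0 addr0 !scale1r gkvhat0.
have kK' := ltnW kK.
rewrite gkwS mulmxDr (IH kK') -scalemxAr gkvhatS (scalerDr _ (vhat k.+1)).
(* The coefficients [gkd k] and [gkd k.+1 * (be k.+1 / al k)] of [vhat k] cancel by the choice of
   [gkd]. *)
rewrite addrCA scalerA -scalerDl mulrA [_ * be _]mulrC mul_beta_gkdS // mulNr.
by rewrite mulrAC divff ?al_neq0 // mul1r subrr scale0r addr0.
Qed.

Lemma dot_mul_gk_z_gkw j k : (j < k < K)%N -> dot (A *m z j) (gkw k) = 0.
Proof.
move=> jkK; have /andP[_ kK] := jkK.
by rewrite dot_mulmx trmx_mul_gkw // dotZr dot_gk_z_vhat ?mulr0.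
Qed.

(** If [gkw k] vanished, so would [vhat k] and then [al k]. This later makes the factor between
    [gkw k] and the residual nonzero. *)
Lemma gkw_neq0 k : (k < K)%N -> gkw k != 0.
Proof.
move=> kK; apply/eqP => w0; have /eqP := trmx_mul_gkw k kK.
rewrite w0 mulmx0 eq_sym scaler_eq0 (negPf (gkd_neq0 _ kK)) /= => /eqP v0.
by have := al_neq0 _ kK; rewrite -dot_z_vhat ?al_neq0 // v0 dot0r eqxx.
Qed.

Lemma gk_z_of_gkw k (r : 'cV[R]_m) c : (k < K)%N -> gkw k = c *: r ->
  z k = (c / (al k * gkd k)) *: (invmx (M k.+1) *m (A^T *m r)).
Proof.
move=> kK wr; have dk := gkd_neq0 _ kK.
rewrite gk_zE -[vhat k](scalerK dk) -trmx_mul_gkw // wr -!scalemxAr !scalerA.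
by rewrite invfM; congr (_ *: _); rewrite mulrA mulrC.
Qed.

End GolubKahan.

(** * Orthogonality in FCGLS *)

Section FCGLS.
Context {R : realType} {m n : nat}.
Variables (A : 'M[R]_(m, n)) (b : 'cV[R]_m) (x0 : 'cV[R]_n).
Variable (M : nat -> 'M[R]_n).

Local Notation run := (cg_run A b x0 M).
Local Notation q := (fcgls_q A b x0 M).
Local Notation shat := (fcgls_shat A b x0 M).
Definition cgr k : 'cV[R]_m := cg_r (run k).
Local Notation r := cgr.

Lemma cg_qsE k :
  [seq pq.2 | pq <- cg_pqs (run k)] = [seq q i | i <- iota 0 k.+1].
Proof.
elim: k => [//|k IH]; rewrite -[k.+2]addn1 iotaD map_cat -IH /=.
rewrite /fcgls_q /= /cg_next; case: (last _ _) => p' q' /=.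
by rewrite last_rcons map_rcons cats1.
Qed.

Lemma cgrS k :
  r k.+1 = r k - (dot (r k) (q k) / enorm (q k) ^+ 2) *: q k.
Proof. by rewrite /cgr /= /cg_next /fcgls_q; case: (last _ _). Qed.

Lemma cg_shatE k : shat k = invmx (M k.+1) *m (A^T *m r k).
Proof.
case: k => [//|k].
by rewrite /fcgls_shat /cgr /= /cg_next; case: (last _ _).
Qed.

Lemma cg_qS k : q k.+1 = A *m shat k.+1 +
  \sum_(pq <- cg_pqs (run k))
    (- dot (A *m shat k.+1) pq.2 / enorm pq.2 ^+ 2) *: pq.2.
Proof.
rewrite /fcgls_q /fcgls_shat -[run k.+1]/(cg_next A M k.+1 (run k)) /cg_next.
by case: (last _ (cg_pqs (run k))) => p' q'; rewrite /= last_rcons.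
Qed.

(** Puts the update in Gram-Schmidt form; the empty sum covers the initial [q 0]. *)
Lemma cg_qE k : q k = A *m shat k -
  \sum_(i < k) (dot (A *m shat k) (q i) / enorm (q i) ^+ 2) *: q i.
Proof.
case: k => [|k]; first by rewrite big_ord0 subr0.
pose F y := (dot (A *m shat k.+1) y / enorm y ^+ 2) *: y.
rewrite cg_qS -(big_mkord xpredT (F \o q)) /index_iota subn0.
rewrite -(big_map q xpredT F) -cg_qsE big_map -sumrN; congr (_ + _).
by apply: eq_bigr => pq _; rewrite mulNr scaleNr.
Qed.

Context {K : nat}.
Hypothesis q_neq0 : forall k, (k.+1 < K)%N -> q k != 0.

Lemma cg_q_orth j k : (j < k < K)%N -> dot (q j) (q k) = 0.
Proof.
elim/ltn_ind: k j => k IH j /andP[jk kK].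
rewrite (cg_qE k); apply: dot_gram_schmidt => //.
  (* Only the vector of smaller index must be nonzero, and [j < k < K] gives [j.+1 < K]. *)
  by apply: q_neq0; apply: leq_ltn_trans kK.
move=> i ik; rewrite neq_ltn => /orP[ij|ji].
  by rewrite dotC IH // ij (ltn_trans jk).
by rewrite IH // ji (ltn_trans ik).
Qed.

(** The step length makes the new residual orthogonal to the latest [q]; orthogonality of the [q]
    preserves the earlier relations. *)
Lemma cg_r_orth j k : (j < k < K)%N -> dot (r k) (q j) = 0.
Proof.
elim: k => [//|k IH] /andP[jk kK].
rewrite cgrS dotC dotBr dotZr; have [->|jk'] := eqVneq j k.
  by rewrite enorm_sqr divfK ?dot_eq0 ?q_neq0 // dotC subrr.
have jkK : (j < k < K)%N by rewrite ltn_neqAle jk' -ltnS jk ltnW.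
by rewrite dotC IH // cg_q_orth // mulr0 subrr.
Qed.

End FCGLS.

(** * Proportionality of [w k] and the FCGLS residual *)

Section Equivalence.
Context {R : realType} {m n : nat}.
Variables (A : 'M[R]_(m, n)) (b : 'cV[R]_m) (x0 : 'cV[R]_n).
Variable (M : nat -> 'M[R]_n).

Local Notation u := (gku A b x0 M).
Local Notation w := (gkw A b x0 M).
Local Notation be k := (ffgk_beta A b x0 M k.+1).
Local Notation al k := (ffgk_alpha A b x0 M k.+1).
Local Notation z k := (ffgk_z A b x0 M k.+1).
Local Notation q := (fcgls_q A b x0 M).
Local Notation shat := (fcgls_shat A b x0 M).
Local Notation r := (cgr A b x0 M).
Local Notation Q k := [seq q i | i <- iota 0 k].

Context {K : nat}.
Hypothesis be_neq0 : forall k, (k < K)%N -> be k != 0.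
Hypothesis al_neq0 : forall k, (k < K)%N -> al k != 0.
Hypothesis q_neq0 : forall k, (k.+1 < K)%N -> q k != 0.

Lemma gk_z_shat k c : (k < K)%N -> c != 0 -> w k = c *: r k ->
  exists2 eta : R, eta != 0 & z k = eta *: shat k.
Proof.
move=> kK c0 wr; exists (c / (al k * gkd A b x0 M k)).
  rewrite mulf_neq0 // invr_eq0 mulf_neq0 ?al_neq0 //.
  exact: (gkd_neq0 _ _ _ _ be_neq0 al_neq0).
by rewrite cg_shatE; apply: (gk_z_of_gkw _ _ _ _ be_neq0 al_neq0).
Qed.

(** [q j] is a multiple of [A *m z j], to which [w k] is orthogonal, minus a combination of earlier
    [q i], handled by induction on [j]. *)
Lemma gkw_orth_q j k : (j < k < K)%N ->
  (forall i, (i < k)%N -> exists2 c : R, c != 0 & w i = c *: r i) ->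
  dot (w k) (q j) = 0.
Proof.
move=> + wr; elim/ltn_ind: j => j IH /andP[jk kK].
have [c c0 wrj] := wr j jk.
have [eta eta0 zs] := gk_z_shat j c (ltn_trans jk kK) c0 wrj.
rewrite cg_qE dotBr dot_sumr big1 ?subr0 => [|i _]; last first.
  by rewrite dotZr IH ?mulr0 // kK (ltn_trans (ltn_ord i)).
rewrite -[shat j](scalerK eta0) -zs -scalemxAr dotZr dotC.
by rewrite (dot_mul_gk_z_gkw _ _ _ _ be_neq0 al_neq0) ?mulr0 ?jk.
Qed.

Lemma gkw_proportional k : (k < K)%N ->
  w k \in <<r k :: Q k>>%VS ->
  (forall i, (i < k)%N -> exists2 c : R, c != 0 & w i = c *: r i) ->
  exists2 c : R, c != 0 & w k = c *: r k.
Proof.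
move=> kK + wr; rewrite span_cons => /memv_addP[_ /vlineP[c ->] [y yQ wE]].
(* Both [w k] and [r k] are orthogonal to the [q j], so [y] is orthogonal to the span that contains
   it. *)
have y0 : y = 0.
  apply/eqP; rewrite -dot_eq0; apply/eqP/(dot_span0 (Q k)) => //.
  move=> x /mapP[j]; rewrite mem_iota /= => jk ->.
  have -> : y = w k - c *: r k by rewrite wE addrC addKr.
  rewrite dotC dotBr dotZr !(dotC (q j)) gkw_orth_q ?jk //.
  by rewrite (cg_r_orth _ _ _ _ q_neq0) ?jk // mulr0 subrr.
exists c; last by rewrite wE y0 addr0.
apply: contraTneq (gkw_neq0 A b x0 M be_neq0 al_neq0 _ kK) => c0.
by rewrite wE y0 c0 scale0r addr0 eqxx.
Qed.

Lemma gkw_mem_span k : (forall i, (i <= k)%N -> u i \in <<r k :: Q k>>%VS) ->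
  w k \in <<r k :: Q k>>%VS.
Proof.
by move=> uQ; apply: rpred_sum => i _; rewrite rpredZ // uQ // -ltnS.
Qed.

(** The new vector [u k.+1] combines earlier [u j] with [A *m z k], a multiple of [A *m shat k],
    which lies in the span of [q 0], ..., [q k]. *)
Lemma gku_mem_span k : (k < K)%N ->
  (forall i, (i < k)%N -> exists2 c : R, c != 0 & w i = c *: r i) ->
  forall i, (i <= k)%N -> u i \in <<r k :: Q k>>%VS.
Proof.
elim: k => [|k IH] kK wr i ik.
  have -> : i = 0%N by apply/eqP; rewrite -leqn0.
  by rewrite gku0 rpredZ // memv_span // mem_head.
have {}IH := IH (ltnW kK) (fun i ik => wr i (ltnW ik)).
have [c c0 wrk] := wr k (ltnSn k).
have [eta eta0 zs] := gk_z_shat k c (ltnW kK) c0 wrk.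
set S := <<_>>%VS.
have qS j : (j <= k)%N -> q j \in S.
  by move=> jk; rewrite memv_span // inE map_f ?orbT // mem_iota.
(* Undoing the residual update keeps the old span inside the new one. *)
have rS : r k \in S.
  rewrite -[r k](subrK ((dot (r k) (q k) / enorm (q k) ^+ 2) *: q k)) -cgrS.
  by rewrite rpredD ?rpredZ ?qS // memv_span // mem_head.
have sub : (<<r k :: Q k>> <= S)%VS.
  apply/span_subvP => y; rewrite inE => /predU1P[->//|/mapP[j]].
  by rewrite mem_iota /= => jk ->; rewrite qS // ltnW.
have uS j : (j <= k)%N -> u j \in S by move=> jk; apply: subvP sub _ (IH j jk).
move: ik; rewrite leq_eqVlt ltnS => /predU1P[->|/uS//].
rewrite gkuS rpredZ // rpredB ?rpred_sum // => [|j _]; last first.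
  by rewrite rpredZ // uS // -ltnS.
rewrite zs -scalemxAr rpredZ //.
rewrite -(subrK
  (\sum_(j < k) (dot (A *m shat k) (q j) / enorm (q j) ^+ 2) *: q j)
  (A *m shat k)) -cg_qE rpredD ?qS // rpred_sum // => j _.
by rewrite rpredZ // qS // ltnW.
Qed.

(** The induction must be strong: both the span membership and the orthogonality at [k] use
    proportionality at all smaller indices. *)
Lemma gkw_residual k : (k < K)%N -> exists2 c : R, c != 0 & w k = c *: r k.
Proof.
elim/ltn_ind: k => k IH kK.
have wr i : (i < k)%N -> exists2 c : R, c != 0 & w i = c *: r i.
  by move=> ik; apply: IH => //; apply: ltn_trans kK.
by apply: gkw_proportional => //; apply/gkw_mem_span/gku_mem_span.
Qed.

End Equivalence.

Theorem theorem3 (R : realType) (m n : nat)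
    (A : 'M[R]_(m, n)) (b : 'cV[R]_m) (x0 : 'cV[R]_n) (M : nat -> 'M[R]_n)
    (hM : forall k : nat, (1 <= k)%N -> spd (M k))
    (K : nat) (hK : (1 <= K)%N)
    (hbeta : forall k : nat, (1 <= k <= K)%N -> ffgk_beta A b x0 M k != 0)
    (halpha : forall k : nat, (1 <= k <= K)%N -> ffgk_alpha A b x0 M k != 0)
    (hq : forall j : nat, (j.+2 <= K)%N -> fcgls_q A b x0 M j != 0) :
  forall k : nat, (1 <= k <= K)%N ->
    exists eta : R, eta != 0 /\
      ffgk_z A b x0 M k = eta *: fcgls_shat A b x0 M k.-1.
Proof.
have be_neq0 k : (k < K)%N -> ffgk_beta A b x0 M k.+1 != 0
  by move=> kK; exact: hbeta.
have al_neq0 k : (k < K)%N -> ffgk_alpha A b x0 M k.+1 != 0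
  by move=> kK; exact: halpha.
case=> [//|k] /= kK.
have [c c0 wr] := gkw_residual A b x0 M be_neq0 al_neq0 hq k kK.
have [eta eta0 zs] := gk_z_shat A b x0 M be_neq0 al_neq0 k c kK c0 wr.
by exists eta.
Qed.
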